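(* Let $F_1$ be a reproducing kernel Hilbert space of real-valued functions on $[0,1]$ with (pointwise) non-negative and measurable kernel $K_1$ such that the constant function $1$ belongs to $F_1$ and is the representer of the integral, i.e. $\int_0^1f(x)\,dx=\langle f,1\rangle$ for all $f\in F_1$. Define $$\kappa=\operatorname*{ess\,sup}_{x\in[0,1]}K_1(x,x).$$ For $d\in\mathbb N$ let $\mathbf S_d=\langle\cdot,1\rangle$ be the integration functional on the $d$-fold tensor product space $\mathbf F_d=F_1\otimes\cdots\otimes F_1$, and let $\mathcal X_n$ be a set of $n$ independent and uniformly distributed points in $[0,1]^d$. If $\kappa>1$, then for any $\delta>0$ there are constants $c>0$ and $a>1$ such that $$\mathbb E\bigl[e(\mathcal X_n,\mathbf S_d)^2\bigr]\ge1-\delta$$ for all $n,d\in\mathbb N$ with $n\le c\,a^d$. If $\kappa=1$, then $e(\mathcal X_n,\mathbf S_d)=0$ holds almost surely for all $n,d\in\mathbb N$.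
   Context: $\mathbb N=\{1,2,\dots\}$. $\mathbf F_d$ is the RKHS on $[0,1]^d$ with kernel $\mathbf K_d(x,y)=\prod_{i=1}^dK_1(x^i,y^i)$. For $\mathcal X_n=\{x_1,\dots,x_n\}\subset[0,1]^d$, $$e(\mathcal X_n,\mathbf S_d)=\inf_{c\in\mathbb R^n}\ \sup_{\|f\|_{\mathbf F_d}\le1}\Bigl|\mathbf S_d(f)-\sum_{j=1}^nc_jf(x_j)\Bigr|.$$ The essential supremum is with respect to Lebesgue measure. *)

(* Defs.v *)
From HB Require Import structures.
From mathcomp Require Import all_boot all_order all_algebra.
From mathcomp Require Import all_classical all_reals all_analysis.
From mathcomp Require Import ess_sup_inf.

Set Implicit Arguments.
Unset Strict Implicit.
Unset Printing Implicit Defensive.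

Import Order.TTheory GRing.Theory Num.Theory.
Import numFieldNormedType.Exports.

Local Open Scope classical_set_scope.
Local Open Scope ring_scope.

(* A Hilbert space of real functions on D is an abstract complete inner product
   space whose elements f are evaluated by [rkhs_ev f]; only the values on D are
   meaningful, and they determine f. *)
Record rkhs (R : realType) (T : Type) (D : set T) (K : T -> T -> R) := Rkhs {
  rkhs_space :> completeNormedModType R;
  rkhs_ip : rkhs_space -> rkhs_space -> R;
  rkhs_ev : rkhs_space -> T -> R;
  rkhs_ipC : forall f g, rkhs_ip f g = rkhs_ip g f;
  rkhs_ip_linear : forall (a : R) f g h,
    rkhs_ip (a *: f + g) h = a * rkhs_ip f h + rkhs_ip g h;
  rkhs_ip_norm : forall f, rkhs_ip f f = `|f| ^+ 2;
  rkhs_ev_linear : forall (a : R) f g x, D x ->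
    rkhs_ev (a *: f + g) x = a * rkhs_ev f x + rkhs_ev g x;
  rkhs_ev_inj : forall f g,
    (forall x, D x -> rkhs_ev f x = rkhs_ev g x) -> f = g;
  rkhs_reproducing : forall x, D x ->
    exists2 k, (forall y, D y -> rkhs_ev k y = K y x)
             & (forall f, rkhs_ip f k = rkhs_ev f x)
}.

Definition is_one (R : realType) (T : Type) (D : set T) (K : T -> T -> R)
    (F : rkhs D K) (h : F) : Prop :=
  forall x, D x -> rkhs_ev h x = 1.

Definition unit_itv (R : realType) : set R := `[0, 1].

Definition cube (R : realType) (d : nat) : set (d.-tuple R) :=
  [set x | forall i, unit_itv (tnth x i)].

Definition prod_kernel (R : realType) (K : R -> R -> R) (d : nat)
    (x y : d.-tuple R) : R :=
  \prod_(i < d) K (tnth x i) (tnth y i).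

Section tensor_power.
Context (R : realType) (K : R -> R -> R) (F : rkhs (@unit_itv R) K).
Context (d : nat) (Fd : rkhs (@cube R d) (@prod_kernel R K d)).

Definition elementary_tensor (f : 'I_d -> F) (g : Fd) : Prop :=
  forall x, cube x -> rkhs_ev g x = \prod_(i < d) rkhs_ev (f i) (tnth x i).

(* Fd is the Hilbert space tensor power of F, realised as the space of functions
   on the cube with kernel [prod_kernel K]. *)
Definition is_tensor_power : Prop :=
  [/\ forall f, exists g, elementary_tensor f g,
      forall f f' g g', elementary_tensor f g -> elementary_tensor f' g' ->
        rkhs_ip g g' = \prod_(i < d) rkhs_ip (f i) (f' i)
    & dense [set g : Fd | exists (m : nat) (t : 'I_m -> Fd),
        (forall k, exists f, elementary_tensor f (t k)) /\
        exists a : 'I_m -> R, g = \sum_(k < m) a k *: t k] ].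

End tensor_power.

(* Extended real valued, so that infimum and supremum are the genuine ones. *)
Definition wce (R : realType) (T : Type) (D : set T) (K : T -> T -> R)
    (F : rkhs D K) (S : F -> R) (n : nat) (x : 'I_n -> T) : \bar R :=
  ereal_inf [set ereal_sup [set (`|S f - \sum_(j < n) c j * rkhs_ev f (x j)|)%:E
                            | f in [set f : F | `|f| <= 1]]
            | c in [set: 'I_n -> R]].

Definition mutually_independent (R : realType) (dO dT : measure_display)
    (Omega : measurableType dO) (T : measurableType dT) (P : probability Omega R)
    (n : nat) (X : 'I_n -> {RV P >-> T}) : Prop :=
  forall (J : {set 'I_n}) (B : 'I_n -> set T), (forall j, measurable (B j)) ->
    P (\bigcap_(j in [set` J]) (X j @^-1` B j)) =
    (\prod_(j in J) P (X j @^-1` B j))%E.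

(* The law of X is the uniform distribution on the cube, i.e. Lebesgue measure
   restricted to the cube, given by its values on measurable boxes. *)
Definition uniform_on_cube (R : realType) (dO : measure_display)
    (Omega : measurableType dO) (P : probability Omega R) (d : nat)
    (X : {RV P >-> d.-tuple (measurableTypeR R)}) : Prop :=
  forall A : 'I_d -> set (measurableTypeR R), (forall i, measurable (A i)) ->
    P (X @^-1` [set x | forall i, A i (tnth x i)]) =
    (\prod_(i < d) lebesgue_measure (A i `&` unit_itv (R:=R)))%E.

Definition iid_uniform (R : realType) (dO : measure_display)
    (Omega : measurableType dO) (P : probability Omega R) (n d : nat)
    (X : 'I_n -> {RV P >-> d.-tuple (measurableTypeR R)}) : Prop :=
  [/\ forall j w, cube (X j w),
      mutually_independent X
    & forall j, uniform_on_cube (X j) ].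

Definition diag_ess_sup (R : realType) (K : R -> R -> R) : \bar R :=
  ess_sup (mrestr lebesgue_measure (measurable_itv `[(0:R), 1]))
    (fun x => (K x x)%:E).

(* Main.v *)
Require Import Defs.
From mathcomp Require Import all_boot all_order all_algebra.
From mathcomp Require Import ring lra.
From mathcomp Require Import all_classical all_reals all_analysis.
From mathcomp Require Import measurable_realfun ess_sup_inf.

(* The squared error is the squared distance of the representer 1 from the span
   of the kernel functions at the sample points, that is, the minimum over c of
   1 - 2 sum_j c_j + c^T G c with the Gram matrix G of the points.  By
   Cauchy-Schwarz K1(t,t) >= 1.  If kappa > 1, then q = int 1/K1(t,t) dt < 1, so
   the diagonal of G exceeds b^d except with probability at most (bq)^d per
   point; off the diagonal K_d >= 0 has expectation 1, because 1 represents the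
   integral, so Markov's inequality bounds those entries.  Hence for
   exponentially many points G is diagonally dominant and 1 is almost orthogonal
   to the span.  If kappa = 1, then K1(t,t) = 1 almost everywhere, which is the
   equality case of Cauchy-Schwarz: the kernel function at almost every point is
   the constant 1, and a single sample integrates exactly. *)

Set Implicit Arguments.
Unset Strict Implicit.
Unset Printing Implicit Defensive.

Import Order.TTheory GRing.Theory Num.Theory.
Import numFieldNormedType.Exports.

Local Open Scope classical_set_scope.
Local Open Scope ring_scope.

(** * Products of independent random elements *)

Lemma integral_mrestr d (T : measurableType d) (R : realType)
    (mu : {measure set T -> \bar R}) (D : set T) (mD : measurable D)
    (f : T -> \bar R) :
  measurable_fun setT f -> (forall x, (0 <= f x)%E) ->
  (\int[mrestr mu mD]_x f x = \int[mu]_(x in D) f x)%E.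
Proof.
move=> mf f0.
rewrite (@ge0_negligible_integral _ _ _ (mrestr mu mD) _ (~` D)) //; last 2 first.
- exact: measurableC.
- by rewrite /= /mrestr setICl measure0.
rewrite setDE setCK setTI; apply: eq_measure_integral => A mA AD.
by rewrite /= /mrestr; congr (mu _); apply/setIidPl.
Qed.

Section reweighting.
Context d1 d2 (Omega : measurableType d1) (T : measurableType d2) (R : realType).
Variable P : {sigma_finite_measure set Omega -> \bar R}.
Variables (h : Omega -> R) (Z : Omega -> T).
Hypotheses (h0 : forall w, 0 <= h w) (mh : measurable_fun setT h)
  (mZ : measurable_fun setT Z).

Let H : set (Omega * measurableTypeR R) := [set p | (0 <= p.2) && (p.2 < h p.1)].

Let mH : measurable H.
Proof.
rewrite (_ : H = [set p | 0 <= p.2] `&` [set p | p.2 < h p.1]); last first.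
  by apply/seteqP; split => p /= => [/andP|] // [? ?]; apply/andP.
apply: measurableI.
- rewrite -[X in measurable X]setTI.
  exact: (measurable_fun_ler (@measurable_cst _ _ _ _ _ _) measurable_snd) measurableT [set true] _.
- rewrite -[X in measurable X]setTI.
  exact: (measurable_fun_ltr measurable_snd (measurableT_comp mh measurable_fst))
    measurableT [set true] _.
Qed.

(* The measure [h P] pushed forward by [Z]: the density [h] is realised by its hypograph. *)
Let mZ1 : measurable_fun setT (Z \o fst : Omega * measurableTypeR R -> T).
Proof. exact: measurableT_comp mZ measurable_fst. Qed.

Let nu : {measure set T -> \bar R} :=
  measure_function_pushforward__canonical__measure_function_Measure
    (mrestr (P \x lebesgue_measure)%E mH) mZ1.

Let integral_nu (f : T -> \bar R) :
  measurable_fun setT f -> (forall x, (0 <= f x)%E) ->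
  (\int[nu]_x f x = \int[P]_w ((h w)%:E * f (Z w)))%E.
Proof.
move=> mf f0.
rewrite ge0_integral_pushforward//= preimage_setT.
rewrite integral_mrestr//; last exact: measurableT_comp mf mZ1.
rewrite integral_mkcond fubini_tonelli1/=; last 2 first.
- apply/(measurable_restrictT _ _).1 => //.
  by apply: measurable_funTS; exact: measurableT_comp mf mZ1.
- by move=> p; rewrite patchE; case: ifP.
apply: eq_integral => w _; rewrite /fubini_F.
transitivity (\int[lebesgue_measure]_(y in `[0%R, h w[) f (Z w))%E; last first.
  rewrite integral_cst//= lebesgue_measure_itv/= lte_fin muleC.
  case: ltP => [|hw]; first by rewrite oppr0 adde0.
  by rewrite (@le_anti _ _ (h w) 0%R) ?h0 ?hw.
rewrite [RHS]integral_mkcond; apply: eq_integral => y _.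
rewrite !patchE; congr (if _ then _ else _).
Qed.

(** Both sides are integrals of [f], one against [nu] and one against [c] times [mu]. These measures
    are finite and agree on a generating pi-system containing the whole space, hence agree
    everywhere. *)
Lemma reweighted_law (mu : {measure set T -> \bar R}) (c : R) (G : set (set T)) :
  0 <= c -> (mu setT < +oo)%E ->
  measurable = <<s G >> -> setI_closed G -> G setT ->
  (forall A, G A -> (\int[P]_w (h w * \1_A (Z w))%:E = c%:E * mu A)%E) ->
  forall f : T -> R, measurable_fun setT f -> (forall x, 0 <= f x) ->
  (\int[P]_w (h w * f (Z w))%:E = c%:E * \int[mu]_x (f x)%:E)%E.
Proof.
move=> c0 muT GE GI GT GP f mf f0.
have mG A : G A -> measurable A by rewrite GE; exact: sub_sigma_algebra.
have nuE A : measurable A -> nu A = (\int[P]_w (h w * \1_A (Z w))%:E)%E.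
  move=> mA; transitivity (\int[nu]_x (\1_A x)%:E)%E.
    by rewrite integral_indic// setIT.
  rewrite integral_nu//.
  exact/measurable_EFinP/measurable_indic.
have nuc A : measurable A -> nu A = mscale (NngNum c0) mu A.
  move=> mA; apply: (measure_unique G (fun=> setT)) => //.
  - by apply/seteqP; split=> // x _; exists 0%N.
  - by move=> B GB; rewrite /mscale/= nuE ?GP//; exact: mG.
  - by move=> _; rewrite nuE// GP// lte_mul_pinfty.
transitivity (\int[nu]_x (f x)%:E)%E.
  rewrite integral_nu//; first exact/measurable_EFinP.
transitivity (\int[mscale (NngNum c0) mu]_x (f x)%:E)%E.
  by apply: eq_measure_integral => A mA _; exact: nuc.
rewrite ge0_integral_mscale//; first exact/measurable_EFinP.
by move=> x _; rewrite lee_fin.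
Qed.
End reweighting.

(** Factors are generalised one at a time. For indicators of sets in [G] the identity is the product
    formula for [P]. To free one factor, the product of the others serves as a density in
    [reweighted_law], which extends the identity from indicators to nonnegative measurable
    functions. *)
Lemma integral_prod_indep d1 d2 (Omega : measurableType d1)
    (T : measurableType d2) (R : realType) (P : probability Omega R)
    (mu : {measure set T -> \bar R}) (G : set (set T)) (d : nat)
    (Z : 'I_d -> Omega -> T) (F : 'I_d -> T -> R) (c : 'I_d -> R) :
  (forall k, measurable_fun setT (Z k)) -> (mu setT < +oo)%E ->
  measurable = <<s G >> -> setI_closed G -> G setT ->
  (forall A : 'I_d -> set T, (forall k, G (A k)) ->
    P (\bigcap_k (Z k @^-1` A k)) = (\prod_k mu (A k))%E) ->
  (forall k, measurable_fun setT (F k)) -> (forall k x, 0 <= F k x) ->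
  (forall k, \int[mu]_x (F k x)%:E = (c k)%:E)%E ->
  (\int[P]_w (\prod_k F k (Z k w))%:E = (\prod_k c k)%:E)%E.
Proof.
move=> mZ muT GE GI GT PG.
have mG A : G A -> measurable A by rewrite GE; exact: sub_sigma_algebra.
(* Induction on [m]: the factors of index below [m] are arbitrary, the remaining ones are
   indicators. At [m = d] the restriction is void. *)
suff claim m (H : 'I_d -> T -> R) (b : 'I_d -> R) :
    (forall k, measurable_fun setT (H k)) -> (forall k x, 0 <= H k x) ->
    (forall k, \int[mu]_x (H k x)%:E = (b k)%:E)%E ->
    (forall k : 'I_d, (m <= k)%N -> exists2 A, G A & H k = \1_A) ->
    (\int[P]_w (\prod_k H k (Z k w))%:E = (\prod_k b k)%:E)%E.
  by move=> mF F0 Fc; apply: (claim d) => // k; rewrite leqNgt ltn_ord.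
elim: m H b => [|m IH] H b mH H0 Hb HG.
  have /choice[A HA] : forall k, exists A, G A /\ H k = \1_A.
    by move=> k; have [A] := HG k (leq0n k); exists A.
  have mA k : measurable (A k) by apply: mG; have [] := HA k.
  pose E := \bigcap_k (Z k @^-1` A k).
  have prodE w : \prod_k H k (Z k w) = \1_E w.
    rewrite indicE; have [Ew|] := boolP (w \in E).
      rewrite big1// => k _; have [_ ->] := HA k.
      by rewrite indicE mem_set//; move: Ew; rewrite inE => /(_ k I).
    rewrite notin_setE => /existsNP[k /not_implyP[_ nA]].
    by rewrite (bigD1 k)//=; have [_ ->] := HA k; rewrite indicE memNset// mul0r.
  under eq_integral do rewrite prodE.
  rewrite integral_indic//; last first.
    apply: fin_bigcap_measurable => //.
    by move=> k _; rewrite -[X in measurable X]setTI; exact: mZ.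
  rewrite setIT; transitivity (\prod_k mu (A k))%E.
    by apply: PG => k; have [] := HA k.
  rewrite -prodEFin; apply: eq_bigr => k _.
  by rewrite -Hb; have [_ ->] := HA k; rewrite integral_indic// setIT.
(* When [d <= m] there is no factor of index [m] to free, and the induction hypothesis applies as it
   is. *)
have [dm|md] := leqP d m.
  by apply: IH => // k mk; move: (ltn_ord k); rewrite ltnNge (leq_trans dm mk).
pose k0 := Ordinal md.
have b0 k : 0 <= b k.
  by rewrite -lee_fin -Hb; apply: integral_ge0 => x _; rewrite lee_fin.
under eq_integral do rewrite (bigD1 k0)//= mulrC.
rewrite (bigD1 k0)//= mulrC EFinM -Hb.
apply: (@reweighted_law _ _ _ _ _ P _ _ _ _ _ mu _ G) => //.
- by move=> w; apply: prodr_ge0.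
- under eq_fun do rewrite big_mkcond/=.
  apply: measurable_prod => k _; case: (k != k0) => //; exact: measurableT_comp.
- by apply: prodr_ge0.
move=> A GA.
have muA : mu A \is a fin_num.
  rewrite ge0_fin_numE// (le_lt_trans _ muT)//.
  by apply: le_measure; rewrite ?inE//; exact: mG.
pose H' k := if k == k0 then \1_A : T -> R else H k.
pose b' k := if k == k0 then fine (mu A) else b k.
have -> : (\int[P]_w (\prod_(k < d | k != k0) H k (Z k w) * \1_A (Z k0 w))%:E =
    \int[P]_w (\prod_k H' k (Z k w))%:E)%E.
  apply: eq_integral => w _; rewrite [in RHS](bigD1 k0)//= mulrC {1}/H' eqxx.
  by congr (_ * _)%:E; apply: eq_bigr => k /negbTE kk0; rewrite /H' kk0.
rewrite (IH H' b').
- rewrite (bigD1 k0)//= {1}/b' eqxx mulrC EFinM fineK//; congr (_%:E * _)%E.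
  by apply: eq_bigr => k /negbTE kk0; rewrite /b' kk0.
- by move=> k; rewrite /H'; case: ifP => // _; apply: measurable_indic; exact: mG.
- by move=> k x; rewrite /H'; case: ifP.
- move=> k; rewrite /H' /b'; case: ifP => // _.
  by rewrite integral_indic ?setIT ?fineK//; exact: mG.
move=> k; rewrite leq_eqVlt => /predU1P[mk|mk].
  by exists A => //; rewrite /H' (_ : k == k0)//; apply/eqP/val_inj.
by rewrite /H' (_ : k == k0 = false); [exact: HG|apply/eqP => kk0; rewrite kk0/= ltnn in mk].
Qed.

(** * Worst-case errors and Gram matrices *)

Section rkhs_theory.
Context (R : realType) (T : Type) (D : set T) (K : T -> T -> R) (F : rkhs D K).

Lemma rkhs_ip0l (f : F) : rkhs_ip 0 f = 0.
Proof.
by have := rkhs_ip_linear 1 0 0 f; rewrite scaler0 addr0 mul1r => h; lra.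
Qed.

Lemma rkhs_ip_lin_suml n (c : 'I_n -> R) (k : 'I_n -> F) (f g : F) :
  rkhs_ip (g - \sum_j c j *: k j) f = rkhs_ip g f - \sum_j c j * rkhs_ip (k j) f.
Proof.
suff sumE : rkhs_ip (\sum_j c j *: k j) f = \sum_j c j * rkhs_ip (k j) f.
  by rewrite addrC -scaleN1r rkhs_ip_linear sumE mulN1r addrC.
elim/big_ind2 : _ => [|a u b v <- <-|j _]; first exact: rkhs_ip0l.
  by have := rkhs_ip_linear 1 u v f; rewrite scale1r mul1r => ->.
by rewrite -[c j *: _]addr0 rkhs_ip_linear rkhs_ip0l addr0.
Qed.

Lemma rkhs_ip_lin_sumr n (c : 'I_n -> R) (k : 'I_n -> F) (f g : F) :
  rkhs_ip f (g - \sum_j c j *: k j) = rkhs_ip f g - \sum_j c j * rkhs_ip f (k j).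
Proof.
rewrite rkhs_ipC rkhs_ip_lin_suml rkhs_ipC; congr (_ - _).
by apply: eq_bigr => j _; rewrite rkhs_ipC.
Qed.

Lemma rkhs_representers n (x : 'I_n -> T) : (forall j, D (x j)) ->
  exists k : 'I_n -> F,
    (forall i j, rkhs_ip (k i) (k j) = K (x j) (x i)) /\
    (forall f j, rkhs_ip f (k j) = rkhs_ev f (x j)).
Proof.
move=> Dx; have /choice[k Hk] : forall j, exists k : F,
    (forall y, D y -> rkhs_ev k y = K y (x j)) /\
    (forall f, rkhs_ip f k = rkhs_ev f (x j)).
  by move=> j; have [k k1 k2] := rkhs_reproducing F (Dx j); exists k.
exists k; split=> [i j|f j]; last by have [_ ->] := Hk j.
by have [_ ->] := Hk j; have [->] := Hk i.
Qed.

Section worst_case_error.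
Variables (one : F) (n : nat) (x : 'I_n -> T) (k : 'I_n -> F).
Hypotheses (one1 : is_one one) (onenorm : rkhs_ip one one = 1)
  (Dx : forall j, D (x j))
  (kK : forall i j, rkhs_ip (k i) (k j) = K (x j) (x i))
  (kE : forall f j, rkhs_ip f (k j) = rkhs_ev f (x j)).

Local Notation residual c := (one - \sum_j c j *: k j).

Lemma rkhs_error_residual (c : 'I_n -> R) (f : F) :
  rkhs_ip f one - \sum_j c j * rkhs_ev f (x j) = rkhs_ip f (residual c).
Proof.
by rewrite rkhs_ip_lin_sumr; congr (_ - _); apply: eq_bigr => j _; rewrite kE.
Qed.

(** Each cross term is the value of the constant 1 at a sample point, by the reproducing property;
    the quadratic term is the Gram form. *)
Lemma sqr_norm_residual (c : 'I_n -> R) :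
  `|residual c| ^+ 2 =
  1 - (\sum_j c j) *+ 2 + \sum_i \sum_j c i * c j * K (x i) (x j).
Proof.
have k1 j : rkhs_ip one (k j) = 1 by rewrite kE one1.
rewrite -rkhs_ip_norm rkhs_ip_lin_suml rkhs_ip_lin_sumr onenorm.
under eq_bigr do rewrite k1 mulr1.
under [X in _ - _ - X]eq_bigr do rewrite rkhs_ip_lin_sumr rkhs_ipC k1 mulrBr mulr1.
rewrite sumrB.
have -> : \sum_i \sum_j c i * c j * K (x i) (x j) =
          \sum_i c i * \sum_j c j * rkhs_ip (k i) (k j).
  rewrite exchange_big/=; apply: eq_bigr => i _; rewrite mulr_sumr.
  by apply: eq_bigr => j _; rewrite kK; ring.
by ring.
Qed.

(** For fixed weights the error functional is the inner product with the residual. Testing it on the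
    normalised residual gives the norm of the residual as a lower bound for the supremum. *)
Lemma wce_ge (r : R) : 0 <= r -> (forall c, r <= `|residual c| ^+ 2) ->
  (r%:E <= wce (fun f : F => rkhs_ip f one) x ^+ 2)%E.
Proof.
move=> r0 rc.
suff h : ((Num.sqrt r)%:E <= wce (fun f : F => rkhs_ip f one) x)%E.
  rewrite -[r in leLHS](sqr_sqrtr r0) EFin_expe.
  have s0 : (0 <= (Num.sqrt r)%:E :> \bar R)%E by rewrite lee_fin sqrtr_ge0.
  by rewrite lee_sqr// (le_trans s0).
apply: le_ereal_inf_tmp => _ [c _ <-].
set v := residual c.
(* Only for positive [r] is the residual known to be nonzero, so that it can be normalised; for
   [r = 0] the zero function suffices. *)
have [->|r_neq0] := eqVneq r 0.
  rewrite sqrtr0; apply: ereal_sup_ubound; exists 0; first by rewrite /= normr0.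
  by rewrite rkhs_error_residual rkhs_ip0l normr0.
have v0 : 0 < `|v|.
  rewrite lt_neqAle normr_ge0 andbT eq_sym; apply/eqP => v0.
  by have := rc c; rewrite -/v v0 expr0n/=; lra.
apply: (@le_trans _ _ (`|v|)%:E).
  by rewrite lee_fin -[leRHS](@ger0_norm _ `|v|)// -sqrtr_sqr ler_sqrt// rc.
apply: ereal_sup_ubound; exists (`|v|^-1 *: v).
  by rewrite /= normrZ ger0_norm ?invr_ge0// mulVf// gt_eqF.
rewrite rkhs_error_residual -/v -[_ *: v]addr0 rkhs_ip_linear rkhs_ip0l addr0.
rewrite rkhs_ip_norm expr2 mulrA mulVf ?mul1r ?gt_eqF//.
by rewrite ger0_norm.
Qed.

Lemma wce_eq0 (c : 'I_n -> R) : residual c = 0 ->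
  wce (fun f : F => rkhs_ip f one) x = 0%E.
Proof.
move=> rc; apply/eqP; rewrite eq_le; apply/andP; split.
  apply: ereal_inf_lbound; exists c => //=.
  apply/eqP; rewrite eq_le; apply/andP; split.
    apply: ge_ereal_sup => _ [f _ <-].
    by rewrite rkhs_error_residual rc rkhs_ipC rkhs_ip0l normr0.
  apply: ereal_sup_ubound; exists 0; first by rewrite /= normr0.
  by rewrite rkhs_error_residual rc rkhs_ip0l normr0.
apply: le_ereal_inf_tmp => _ [c' _ <-].
apply: ereal_sup_ubound; exists 0; first by rewrite /= normr0.
by rewrite rkhs_error_residual rkhs_ip0l normr0.
Qed.

End worst_case_error.
End rkhs_theory.

(** Cauchy-Schwarz against the all-ones vector, read off from the nonnegative sum of all
    [(c i - c j) ^+ 2]. *)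
Lemma sqr_sum_le (R : realFieldType) n (c : 'I_n -> R) :
  (\sum_j c j) ^+ 2 <= n%:R * \sum_j c j ^+ 2.
Proof.
have : 0 <= \sum_i \sum_j (c i - c j) ^+ 2.
  by apply: sumr_ge0 => i _; apply: sumr_ge0 => j _; exact: sqr_ge0.
have -> : \sum_i \sum_j (c i - c j) ^+ 2 =
    (n%:R * \sum_j c j ^+ 2) *+ 2 - ((\sum_j c j) ^+ 2) *+ 2.
  under eq_bigr do under eq_bigr do rewrite sqrrB.
  under eq_bigr do rewrite big_split/= sumrB sumr_const card_ord sumrMnl -mulr_sumr.
  rewrite big_split/= sumrB !sumrMnl sumr_const card_ord -mulr_suml -mulr_natl.
  by ring.
by lra.
Qed.

(** Diagonal dominance, proved term by term: off the diagonal, the product of [c i] and [c j] is at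
    least minus half the sum of their squares. The diagonal also gives up [M * c i ^+ 2], which
    turns the count [n - 1] into the simpler [n]. *)
Lemma quadratic_form_ge (R : realFieldType) n (G : 'I_n -> 'I_n -> R) (B M : R)
    (c : 'I_n -> R) :
  (forall i, B <= G i i) -> (forall i j, 0 <= G i j) ->
  (forall i j, i != j -> G i j <= M) -> 0 <= M ->
  (B - n%:R * M) * \sum_j c j ^+ 2 <= \sum_i \sum_j c i * c j * G i j.
Proof.
move=> GB G0 GM M0.
have -> : (B - n%:R * M) * \sum_j c j ^+ 2 =
    \sum_i \sum_j ((i == j)%:R * B * c i ^+ 2 - M * (c i ^+ 2 + c j ^+ 2) / 2).
  under [RHS]eq_bigr do rewrite sumrB.
  rewrite sumrB.
  have -> : \sum_i \sum_j (i == j)%:R * B * c i ^+ 2 = B * \sum_j c j ^+ 2.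
    rewrite mulr_sumr; apply: eq_bigr => i _.
    rewrite (bigD1 i)//= eqxx mul1r big1 ?addr0// => j ji.
    by rewrite eq_sym (negbTE ji) !mul0r.
  under [X in _ = _ - X]eq_bigr do rewrite -mulr_suml -mulr_sumr big_split/= sumr_const card_ord.
  rewrite -mulr_suml -mulr_sumr big_split/= sumr_const card_ord sumrMnl
    -[(\sum_(i < n) _) *+ n]mulr_natl.
  by field.
apply: ler_sum => i _; apply: ler_sum => j _.
have [<-|ij] := eqVneq i j.
  by have := GB i; have := sqr_ge0 (c i); rewrite mul1r => ? ?; nra.
rewrite !mul0r sub0r.
have := G0 i j; have := GM i j ij => ? ?.
have := sqr_ge0 (c i + c j); have := sqr_ge0 (c i - c j); nra.
Qed.

(** * Uniformly distributed points *)

(** Immediate from the integral as a supremum over simple functions below the integrand, so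
    measurability plays no part. It is applied to the worst-case error, whose measurability in the
    sample is never established. *)
Lemma le_integral_ge0 d (T : measurableType d) (R : realType)
    (mu : {measure set T -> \bar R}) (f g : T -> \bar R) :
  (forall x, (0 <= f x)%E) -> (forall x, (f x <= g x)%E) ->
  (\int[mu]_x f x <= \int[mu]_x g x)%E.
Proof.
move=> f0 fg; have g0 x : (0 <= g x)%E by exact: le_trans (f0 x) (fg x).
rewrite !ge0_integralTE//; apply: ereal_sup_le => _ [h hf <-].
by exists h => // x; exact: le_trans (hf x) (fg x).
Qed.

Section uniform_law.
Context (R : realType).
Local Notation U := (uniform_prob (@ltr01 R)).

Lemma integral_uniform01 (f : R -> \bar R) :
  measurable_fun setT f -> (forall x, (0 <= f x)%E) ->
  (\int[U]_x f x = \int[lebesgue_measure]_(x in @unit_itv R) f x)%E.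
Proof. by move=> mf f0; rewrite integral_uniform// subr0 invr1 mul1e. Qed.

Lemma uniform01E (A : set (measurableTypeR R)) : measurable A ->
  U A = lebesgue_measure (A `&` @unit_itv R).
Proof.
move=> mA; transitivity (\int[U]_x (\1_A x)%:E)%E.
  by rewrite integral_indic// setIT.
rewrite integral_uniform01//; last exact/measurable_EFinP/measurable_indic.
by rewrite integral_indic//; exact: measurable_itv.
Qed.

Context dO (Omega : measurableType dO) (P : probability Omega R) (d : nat).

Lemma measurable_coord (X : {RV P >-> d.-tuple (measurableTypeR R)}) k :
  measurable_fun setT (fun w => tnth (X w) k : measurableTypeR R).
Proof. exact: measurableT_comp (measurable_tnth k) (measurable_funPT X). Qed.

Lemma integral_prod_uniform (X : {RV P >-> d.-tuple (measurableTypeR R)})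
    (f : measurableTypeR R -> R) (q : R) : uniform_on_cube X ->
  measurable_fun setT f -> (forall x, 0 <= f x) ->
  (\int[U]_x (f x)%:E = q%:E)%E ->
  (\int[P]_w (\prod_k f (tnth (X w) k))%:E = (q ^+ d)%:E)%E.
Proof.
move=> unifX mf f0 fq.
rewrite (@integral_prod_indep _ _ _ _ _ P U measurable _ _ (fun=> f) (fun=> q))//.
- by rewrite prodr_const card_ord.
- exact: measurable_coord.
- exact: le_lt_trans (probability_le1 U measurableT) (ltry 1).
- by rewrite sigma_algebra_id//; exact: sigma_algebra_measurable.
- exact: measurableI.
move=> A mA; transitivity (P (X @^-1` [set x | forall i, A i (tnth x i)])).
  congr (P _); apply/seteqP; split => w /= Aw => [k|k _]; last exact: Aw.
  exact: Aw.
rewrite unifX//; apply: eq_bigr => k _; exact/esym/uniform01E.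
Qed.

(** For distinct points the pairs of [k]-th coordinates are independent over [k] with law [U \x U].
    It is enough to test rectangles: the event then splits into a box event for [X i] and one for
    [X j], which are independent. *)
Lemma integral_prod_uniform_pair n (X : 'I_n -> {RV P >-> d.-tuple (measurableTypeR R)})
    (i j : 'I_n) (f : measurableTypeR R * measurableTypeR R -> R) (q : R) :
  iid_uniform X -> i != j ->
  measurable_fun setT f -> (forall x, 0 <= f x) ->
  (\int[(U \x U)%E]_x (f x)%:E = q%:E)%E ->
  (\int[P]_w (\prod_k f (tnth (X i w) k, tnth (X j w) k))%:E = (q ^+ d)%:E)%E.
Proof.
move=> [Xcube Xind Xunif] ij mf f0 fq.
pose G : set (set (measurableTypeR R * measurableTypeR R)) :=
  [set A `*` B | A in measurable & B in measurable].
rewrite (@integral_prod_indep _ _ _ _ _ P (U \x U)%E G _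
  (fun k w => (tnth (X i w) k, tnth (X j w) k)) (fun=> f) (fun=> q))//.
- by rewrite prodr_const card_ord.
- by move=> k; apply/measurable_fun_pairP; split; exact: measurable_coord.
- exact: le_lt_trans (probability_le1 (U \x U)%E measurableT) (ltry 1).
- exact: measurable_prod_measurableType.
- move=> _ _ [A mA [B mB <-]] [A' mA' [B' mB' <-]]; rewrite -setXI.
  by exists (A `&` A'); [exact: measurableI|exists (B `&` B') => //; exact: measurableI].
- by exists setT => //; exists setT => //; rewrite setXTT.
move=> C GC.
have /choice[AB HAB] : forall k, exists AB : set (measurableTypeR R) * set (measurableTypeR R),
    [/\ measurable AB.1, measurable AB.2 & C k = AB.1 `*` AB.2].
  by move=> k; have [A mA [B mB AB]] := GC k; exists (A, B).
have mA k : measurable (AB k).1 by have [] := HAB k.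
have mB k : measurable (AB k).2 by have [] := HAB k.
(* The box for [X i] is made of the first sides of the rectangles, that for [X j] of the second
   sides; no other [l] matters. *)
pose S l : set (d.-tuple (measurableTypeR R)) := [set x | forall k, 
  (if l == i then (AB k).1 else (AB k).2) (tnth x k)].
have mS l : measurable (S l).
  have -> : S l = \bigcap_k ((@tnth d (measurableTypeR R))^~ k @^-1`
       (if l == i then (AB k).1 else (AB k).2)).
    by apply/seteqP; split => x /= Sx k; [move=> _|]; exact: Sx.
  apply: fin_bigcap_measurable => // k _.
  rewrite -[X in measurable X]setTI; apply: measurable_tnth => //.
  by case: ifP.
transitivity (P (\bigcap_(l in [set` [set i; j]%SET]) (X l @^-1` S l))).
  congr (P _); apply/seteqP; split => w /=.
    move=> Cw l; rewrite /= !inE => /orP[] /eqP -> k.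
      by rewrite eqxx; have := Cw k I; have [_ _ ->] := HAB k => -[].
    by rewrite eq_sym (negbTE ij); have := Cw k I; have [_ _ ->] := HAB k => -[].
  move=> Sw k _; have [_ _ ->] := HAB k; split => /=.
    by have := Sw i; rewrite /= !inE eqxx => /(_ isT k); rewrite eqxx.
  by have := Sw j; rewrite /= !inE eqxx orbT => /(_ isT k); rewrite eq_sym (negbTE ij).
have PS l : P (X l @^-1` S l) = (\prod_k lebesgue_measure
    ((if l == i then (AB k).1 else (AB k).2) `&` @unit_itv R))%E.
  by rewrite (Xunif l (fun k => if l == i then (AB k).1 else (AB k).2))// => k; case: ifP.
rewrite Xind// big_setU1/= ?inE// big_set1 !PS -big_split/=.
apply: eq_bigr => k _; have [_ _ ->] := HAB k.
rewrite eqxx eq_sym (negbTE ij); apply/esym.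
transitivity (U (AB k).1 * U (AB k).2)%E; first exact: product_measure1E.
by congr (_ * _)%E; exact: uniform01E.
Qed.

End uniform_law.

(** * Integrals of the univariate kernel *)

Section kernel_integrals.
Context (R : realType) (K1 : R -> R -> R).
Local Notation U := (uniform_prob (@ltr01 R)).
Local Notation I01 := (@unit_itv R : set (measurableTypeR R)).
Hypotheses (K1_ge0 : forall x y, unit_itv x -> unit_itv y -> 0 <= K1 x y)
  (K1_meas : measurable_fun
     (@unit_itv R `*` @unit_itv R : set (measurableTypeR R * measurableTypeR R))
     (fun p => K1 p.1 p.2)).
Variables (F1 : rkhs (@unit_itv R) K1) (one1 : F1).
Hypotheses (one1E : is_one one1)
  (one1_int : forall f : F1,
     lebesgue_measure.-integrable (@unit_itv R) (EFin \o rkhs_ev f) /\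
     (\int[lebesgue_measure]_(x in @unit_itv R) (rkhs_ev f x)%:E
        = (rkhs_ip f one1)%:E)%E).

Let mI : measurable I01. Proof. exact: measurable_itv. Qed.

Let lebI : lebesgue_measure I01 = 1%E.
Proof. by rewrite /unit_itv lebesgue_measure_itv/= lte_fin ltr01 oppr0 adde0. Qed.

(** Extension by zero gives a function measurable and nonnegative on the whole plane, as Tonelli and
    the product formula require. *)
Definition kernel_ext : measurableTypeR R * measurableTypeR R -> R :=
  (fun p => K1 p.1 p.2) \_ (I01 `*` I01).

(** The reciprocal is written as a real power so that measurability follows from
    [measurable_powR]. *)
Definition inv_diag : measurableTypeR R -> R :=
  (fun t => (K1 t t) `^ (-1)) \_ I01.

Lemma kernel_extE x y : unit_itv x -> unit_itv y -> kernel_ext (x, y) = K1 x y.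
Proof. by move=> Ix Iy; rewrite /kernel_ext patchE mem_set. Qed.

Lemma kernel_ext_ge0 p : 0 <= kernel_ext p.
Proof.
by rewrite /kernel_ext patchE; case: ifPn => //; rewrite inE => -[? ?]; exact: K1_ge0.
Qed.

Lemma measurable_kernel_ext : measurable_fun setT kernel_ext.
Proof. by apply/(measurable_restrictT _ _).1 => //; exact: measurableX. Qed.

Lemma ip_one1 : rkhs_ip one1 one1 = 1.
Proof.
apply: EFin_inj; rewrite -(one1_int one1).2.
rewrite (eq_integral (cst 1%E)); last by move=> x; rewrite inE => /one1E ->.
rewrite integral_cst// mul1e; exact: lebI.
Qed.

(** By Tonelli: for fixed [x] in the interval, the inner integral is that of the kernel function at
    [x], which is its inner product with 1, that is, the value of 1 at [x]. *)
Lemma integral_kernel_ext : (\int[(U \x U)%E]_p (kernel_ext p)%:E = 1%:E)%E.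
Proof.
rewrite fubini_tonelli1/=; last 2 first.
- by apply/measurable_EFinP; exact: measurable_kernel_ext.
- by move=> p; rewrite lee_fin kernel_ext_ge0.
transitivity (\int[U]_x (\1_I01 x)%:E)%E; last first.
  by rewrite integral_indic// setIT; transitivity (lebesgue_measure (I01 `&` I01));
    [exact: uniform01E|rewrite setIid].
apply: eq_integral => x _; rewrite /fubini_F integral_uniform01; last 2 first.
- apply/measurable_EFinP; apply: measurableT_comp measurable_kernel_ext _.
  exact: pair1_measurable.
- by move=> y; rewrite lee_fin kernel_ext_ge0.
rewrite indicE; have [xI|xI] := boolP (x \in I01).
  have [k kE kip] := rkhs_reproducing F1 (set_mem xI).
  transitivity (\int[lebesgue_measure]_(y in I01) (rkhs_ev k y)%:E)%E.
    have sym y : unit_itv y -> K1 x y = K1 y x.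
      move=> Iy; have [l lE lip] := rkhs_reproducing F1 Iy.
      by rewrite -kE// -lip rkhs_ipC kip lE//; exact: set_mem.
    apply: eq_integral => y /set_mem yI.
    by rewrite kernel_extE ?kE ?sym//; exact: set_mem.
  by rewrite (one1_int k).2 rkhs_ipC kip one1E//; exact: set_mem.
apply: integral0_eq => y _; rewrite /kernel_ext patchE ifF//.
by apply/negbTE; apply: contra xI; rewrite !inE => -[].
Qed.

(** The squared distance between the kernel function at [t] and the constant 1 equals
    [K1 t t - 1]. *)
Lemma kernel_diag_ge1 t : unit_itv t -> 1 <= K1 t t.
Proof.
move=> It; have [k kE kip] := rkhs_reproducing F1 It.
have : 0 <= rkhs_ip (1 *: k + (-1) *: one1) (1 *: k + (-1) *: one1).
  by rewrite rkhs_ip_norm.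
have kk : rkhs_ip k k = K1 t t by rewrite kip kE.
have k1 : rkhs_ip one1 k = 1 by rewrite kip one1E.
have lin f : rkhs_ip (1 *: k + (-1) *: one1) f = rkhs_ip k f - rkhs_ip one1 f.
  rewrite rkhs_ip_linear mul1r -[(-1) *: one1]addr0 rkhs_ip_linear rkhs_ip0l.
  by rewrite addr0 mulN1r.
by rewrite lin rkhs_ipC lin [rkhs_ip one1 (_ + _)]rkhs_ipC lin kk
  [rkhs_ip k one1]rkhs_ipC k1 ip_one1; lra.
Qed.

Lemma inv_diagE t : unit_itv t -> inv_diag t = (K1 t t)^-1.
Proof.
move=> It; rewrite /inv_diag patchE mem_set// powR_inv1//.
exact: le_trans (kernel_diag_ge1 It).
Qed.

Lemma inv_diag_ge0 t : 0 <= inv_diag t.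
Proof. by rewrite /inv_diag patchE; case: ifP => // _; exact: powR_ge0. Qed.

Lemma inv_diag_le1 t : inv_diag t <= 1.
Proof.
have [It|nI] := pselect (unit_itv t).
  by rewrite inv_diagE// invf_le1 ?kernel_diag_ge1// (lt_le_trans ltr01)// kernel_diag_ge1.
by rewrite /inv_diag patchE memNset.
Qed.

Lemma measurable_kernel_diag : measurable_fun I01 (fun t => K1 t t).
Proof.
apply: (@measurable_comp _ _ _ _ (measurableTypeR R * measurableTypeR R)%type _
  (I01 `*` I01) (fun p => K1 p.1 p.2) I01 (fun t => (t, t))) => //.
- exact: measurableX.
- by move=> _ [t It <-].
- by apply: measurable_funTS; exact: measurable_fun_pair.
Qed.

Lemma measurable_inv_diag : measurable_fun setT inv_diag.
Proof.
apply/(measurable_restrictT _ _).1 => //.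
exact: measurableT_comp (measurable_powR (-1)) measurable_kernel_diag.
Qed.

(** The integrand is at most 1. Were its integral 1, it would equal 1 almost everywhere, so the
    diagonal would be almost everywhere 1 and its essential supremum at most 1. *)
Lemma integral_inv_diag_lt1 : (1 < diag_ess_sup K1)%E ->
  exists2 q : R, 0 <= q < 1 & (\int[U]_t (inv_diag t)%:E = q%:E)%E.
Proof.
move=> K1_gt1.
have le1 : (\int[U]_t (inv_diag t)%:E <= 1)%E.
  rewrite -(@probability_setT _ _ _ U) -[leRHS]mul1e -integral_cst//.
  apply: le_integral_ge0 => t; rewrite lee_fin ?inv_diag_ge0//.
  exact: inv_diag_le1.
have ge0 : (0 <= \int[U]_t (inv_diag t)%:E)%E.
  by apply: integral_ge0 => t _; rewrite lee_fin inv_diag_ge0.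
have fin : (\int[U]_t (inv_diag t)%:E)%E \is a fin_num.
  by rewrite ge0_fin_numE// (le_lt_trans le1)// ltry.
exists (fine (\int[U]_t (inv_diag t)%:E)%E); last by rewrite fineK.
rewrite fine_ge0//= lt_neqAle; apply/andP; split; last by rewrite -lee_fin fineK.
apply/eqP => int1; move: K1_gt1; rewrite ltNge => /negP; apply; apply/ess_supP.
have {}int1 : (\int[U]_t (inv_diag t)%:E = 1)%E by rewrite -(fineK fin) int1.
have m1 : measurable_fun setT (fun t => (1 - inv_diag t)%:E).
  by apply/measurable_EFinP; apply: measurable_funB => //; exact: measurable_inv_diag.
have ge1 t : (0 <= (1 - inv_diag t)%:E)%E by rewrite lee_fin subr_ge0 inv_diag_le1.
have : (\int[U]_t `|(1 - inv_diag t)%:E| = 0)%E.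
  under eq_integral do rewrite gee0_abs//.
  have : (\int[U]_t ((1 - inv_diag t)%:E + (inv_diag t)%:E) = 1)%E.
    under eq_integral do rewrite -EFinD subrK.
    by rewrite integral_cst// mul1e; exact: probability_setT.
  rewrite ge0_integralD//; last 2 first.
  - by move=> t _; rewrite lee_fin inv_diag_ge0.
  - by apply/measurable_EFinP; exact: measurable_inv_diag.
  rewrite int1; case: (\int[U]_t _)%E => //= r.
  by rewrite -EFinD => -[] r1; congr (_%:E); lra.
move=> /(ae_eq_integral_abs _ measurableT m1).1 [N [mN N0 subN]].
(* Nothing is known about [K1] off the interval, so its complement, null for the restricted measure,
   joins the exceptional set. *)
exists (N `|` ~` I01); split.
- by apply: measurableU => //; exact: measurableC.
- rewrite /= /mrestr setIUl setICl setU0 -N0; apply/esym; exact: uniform01E.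
move=> t /= Kt; have [It|nI] := pselect (unit_itv t); last by right.
left; apply: subN => /= h; apply: Kt; rewrite lee_fin.
have := h I; rewrite inv_diagE// => -[] /eqP; rewrite subr_eq0 => /eqP K1t.
by rewrite -[K1 t t]invrK -K1t invr1.
Qed.

End kernel_integrals.

(** * The expected error *)

(** With [s] the sum of the weights, diagonal dominance and Cauchy-Schwarz bound the Gram form below
    by [s ^+ 2 / e]. Completing the square then gives [1 - s *+ 2 + s ^+ 2 / e >= 1 - e]. *)
Lemma wce_ge_gram (R : realType) (T : Type) (D : set T) (K : T -> T -> R)
    (F : rkhs D K) (one : F) n (x : 'I_n -> T) (B M e : R) :
  is_one one -> rkhs_ip one one = 1 -> (forall j, D (x j)) ->
  0 < e <= 1 -> 0 <= M -> (forall i, B <= K (x i) (x i)) ->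
  (forall i j, 0 <= K (x i) (x j)) ->
  (forall i j, i != j -> K (x i) (x j) <= M) ->
  n%:R / e + n%:R * M <= B ->
  ((1 - e)%:E <= wce (fun f : F => rkhs_ip f one) x ^+ 2)%E.
Proof.
move=> one1 onenorm Dx /andP[e0 e1] M0 KB K0 KM nB.
have [k [kK kE]] := rkhs_representers F Dx.
apply: (wce_ge (k := k)) => //; first by rewrite subr_ge0.
move=> c; rewrite (sqr_norm_residual one1 onenorm Dx kK kE).
have := sqr_sum_le c; set s := \sum_j c j; set t := \sum_j c j ^+ 2 => sn.
have t0 : 0 <= t by apply: sumr_ge0 => j _; exact: sqr_ge0.
have := quadratic_form_ge c KB K0 KM M0; rewrite -/t; set Q := \sum_i _ => tQ.
have : s ^+ 2 / e <= Q.
  apply: le_trans tQ.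
  apply: (@le_trans _ _ (n%:R / e * t)); last by apply: ler_wpM2r => //; lra.
  by rewrite [n%:R / e * t]mulrAC ler_pM2r ?invr_gt0.
have : 0 <= (s - e) ^+ 2 / e by rewrite divr_ge0 ?sqr_ge0// ltW.
have -> : (s - e) ^+ 2 / e = s ^+ 2 / e - s *+ 2 + e by field; rewrite gt_eqF.
by lra.
Qed.

Section tensor_power_integration.
Context (R : realType) (K1 : R -> R -> R).
Hypotheses (K1_ge0 : forall x y, unit_itv x -> unit_itv y -> 0 <= K1 x y)
  (K1_meas : measurable_fun
     (@unit_itv R `*` @unit_itv R : set (measurableTypeR R * measurableTypeR R))
     (fun p => K1 p.1 p.2)).
Variables (F1 : rkhs (@unit_itv R) K1) (one1 : F1).
Hypotheses (one1E : is_one one1)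
  (one1_int : forall f : F1,
     lebesgue_measure.-integrable (@unit_itv R) (EFin \o rkhs_ev f) /\
     (\int[lebesgue_measure]_(x in @unit_itv R) (rkhs_ev f x)%:E
        = (rkhs_ip f one1)%:E)%E).
Local Notation U := (uniform_prob (@ltr01 R)).
Context (n d : nat) (Fd : rkhs (@cube R d) (@prod_kernel R K1 d)) (oned : Fd).
Hypotheses (Fd_tensor : is_tensor_power F1 Fd) (onedE : is_one oned).
Context (dO : measure_display) (Omega : measurableType dO) (P : probability Omega R)
  (X : 'I_n -> {RV P >-> d.-tuple (measurableTypeR R)}).
Hypothesis X_iid : iid_uniform X.

Lemma ip_oned : rkhs_ip oned oned = 1.
Proof.
have [_ ipM _] := Fd_tensor.
have onedT : elementary_tensor (fun=> one1) oned.
  by move=> x cx; rewrite onedE// big1// => i _; rewrite one1E.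
rewrite (ipM _ _ _ _ onedT onedT) big1// => i _; exact: (ip_one1 one1E one1_int).
Qed.

Let Xcube j w : cube (X j w). Proof. by have [] := X_iid. Qed.

Let Kd_ge0 i j w : 0 <= prod_kernel K1 (X i w) (X j w).
Proof. by apply: prodr_ge0 => k _; apply: K1_ge0; exact: Xcube. Qed.

(** The parameters [b ^+ d] and [M] are the thresholds for diagonal and off-diagonal Gram entries,
    and [e] is the loss when all entries respect them. The subtracted sum bounds the mean of [H],
    which is at least 1 at every sample violating a threshold. *)
Lemma wce_expectation_ge (q b M e : R) :
  0 <= q -> (\int[U]_t (inv_diag K1 t)%:E = q%:E)%E ->
  0 < b -> 0 < M -> 0 < e <= 1 -> n%:R / e + n%:R * M <= b ^+ d ->
  (((1 - e) * (1 - (n%:R * (b * q) ^+ d + n%:R ^+ 2 / M)))%:E <=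
    \int[P]_w (wce (fun f : Fd => rkhs_ip f oned) (fun j => X j w)) ^+ 2)%E.
Proof.
move=> q0 intq b0 M0 e01 nB; have /andP[e0 e1] := e01.
have bd0 : 0 < b ^+ d by rewrite exprn_gt0.
(* [t i j w < 1] says that entry [(i, j)] of the Gram matrix is good, so one
   bound on the mean of the sum [H] replaces Markov and union bounds. *)
pose t i j w : R := if i == j then b ^+ d * \prod_k inv_diag K1 (tnth (X i w) k)
  else M^-1 * \prod_k kernel_ext K1 (tnth (X i w) k, tnth (X j w) k).
pose H w := \sum_i \sum_j t i j w.
have t0 i j w : 0 <= t i j w.
  rewrite /t; case: ifP => _; apply: mulr_ge0.
  - exact: ltW.
  - by apply: prodr_ge0 => k _; exact: inv_diag_ge0.
  - by rewrite invr_ge0 ltW.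
  - by apply: prodr_ge0 => k _; exact: kernel_ext_ge0.
have H0 w : 0 <= H w by apply: sumr_ge0 => i _; apply: sumr_ge0 => j _.
have tH i j w : t i j w <= H w.
  rewrite /H (bigD1 i)//= (bigD1 j)//= -addrA lerDl addr_ge0//.
    by apply: sumr_ge0.
  by apply: sumr_ge0 => ? _; apply: sumr_ge0.
have good w : H w < 1 ->
    ((1 - e)%:E <= wce (fun f : Fd => rkhs_ip f oned) (fun j => X j w) ^+ 2)%E.
  move=> H1; apply: (wce_ge_gram (B := b ^+ d) (M := M)) => //.
  - exact: ip_oned.
  - exact: ltW.
  - move=> i; have := le_lt_trans (tH i i w) H1; rewrite /t eqxx.
    under eq_bigr do rewrite (inv_diagE one1E one1_int (Xcube i w _)).
    rewrite prodfV => h.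
    have p0 : 0 < prod_kernel K1 (X i w) (X i w).
      apply: prodr_gt0 => k _; apply: lt_le_trans ltr01 _.
      exact: (kernel_diag_ge1 one1E one1_int (Xcube i w k)).
    by rewrite ltW// -[ltRHS]mul1r -ltr_pdivrMr.
  move=> i j ij; have := le_lt_trans (tH i j w) H1; rewrite /t (negbTE ij).
  under eq_bigr do rewrite (kernel_extE _ (Xcube i w _) (Xcube j w _)).
  by rewrite mulrC ltr_pdivrMr// mul1r => /ltW.
have mt i j : measurable_fun setT (t i j).
  rewrite /t; case: (i == j); apply: measurable_funM => //;
    apply: measurable_prod => k _.
    apply: (measurableT_comp (measurable_inv_diag K1_meas)).
    exact: measurable_coord.
  apply: (measurableT_comp (measurable_kernel_ext K1_meas)).
  by apply: measurable_fun_pair; exact: measurable_coord.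
have intt i j : (\int[P]_w (t i j w)%:E = (if i == j then (b * q) ^+ d else M^-1)%:E)%E.
  have mp k : measurable_fun setT (fun w => inv_diag K1 (tnth (X i w) k)).
    apply: (measurableT_comp (measurable_inv_diag K1_meas)).
    exact: measurable_coord.
  rewrite /t; have [_|ij] := eqVneq i j.
    under eq_integral do rewrite EFinM.
    rewrite ge0_integralZl_EFin//; last 3 first.
    - by move=> w _; rewrite lee_fin; apply: prodr_ge0 => k _; exact: inv_diag_ge0.
    - by apply/measurable_EFinP; apply: measurable_prod => k _.
    - exact: ltW.
    rewrite (integral_prod_uniform _ (measurable_inv_diag K1_meas) (@inv_diag_ge0 _ K1) intq).
      by rewrite -EFinM exprMn.
    by have [] := X_iid.
  under eq_integral do rewrite EFinM.
  rewrite ge0_integralZl_EFin//; last 3 first.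
  - by move=> w _; rewrite lee_fin; apply: prodr_ge0 => k _; exact: kernel_ext_ge0.
  - apply/measurable_EFinP; apply: measurable_prod => k _.
    apply: (measurableT_comp (measurable_kernel_ext K1_meas)).
    by apply: measurable_fun_pair; exact: measurable_coord.
  - by rewrite invr_ge0 ltW.
  rewrite (integral_prod_uniform_pair X_iid ij (measurable_kernel_ext K1_meas)
    (kernel_ext_ge0 K1_ge0) (integral_kernel_ext K1_ge0 K1_meas one1E one1_int)).
  by rewrite expr1n mule1.
have mH : measurable_fun setT H.
  by apply: measurable_sum => i; apply: measurable_sum => j.
have intH : (\int[P]_w (H w)%:E <= (n%:R * (b * q) ^+ d + n%:R ^+ 2 / M)%:E)%E.
  have -> : (\int[P]_w (H w)%:E = \sum_i \sum_j \int[P]_w (t i j w)%:E)%E.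
    under eq_integral do rewrite -sumEFin.
    rewrite ge0_integral_sum//; last 2 first.
    - by move=> i; apply/measurable_EFinP; apply: measurable_sum.
    - by move=> i w _; rewrite lee_fin; apply: sumr_ge0.
    apply: eq_bigr => i _; under eq_integral do rewrite -sumEFin.
    rewrite ge0_integral_sum// => [j|j w _]; first exact/measurable_EFinP.
    by rewrite lee_fin.
  under eq_bigr do under eq_bigr do rewrite intt.
  under eq_bigr do rewrite sumEFin.
  rewrite sumEFin lee_fin.
  have -> : n%:R * (b * q) ^+ d + n%:R ^+ 2 / M =
      \sum_(i < n) ((b * q) ^+ d + n%:R / M).
    by rewrite sumr_const card_ord -mulr_natl; ring.
  apply: ler_sum => i _; rewrite (bigD1 i)//= eqxx lerD2l.
  apply: (@le_trans _ _ (\sum_(j < n) M^-1)); last first.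
    by rewrite sumr_const card_ord -[M^-1 *+ _]mulr_natl.
  rewrite [leRHS](bigD1 i)//=; apply: ler_wpDl; first by rewrite invr_ge0 ltW.
  by apply: ler_sum => j; rewrite eq_sym => /negbTE ->.
(* A measurable minorant of the squared error: at most [1 - e] where [H w < 1], and zero elsewhere.
   Its mean is bounded by integrating [1 <= Num.max (1 - H w) 0 + H w]. *)
pose L w := (1 - e) * Num.max (1 - H w) 0.
have L0 w : 0 <= L w by rewrite mulr_ge0 ?subr_ge0// le_max lexx orbT.
have mmax : measurable_fun setT (fun w => Num.max (1 - H w) 0).
  by apply: measurable_maxr => //; exact: measurable_funB.
apply: (@le_trans _ _ (\int[P]_w (L w)%:E)%E); last first.
  apply: le_integral_ge0 => w; first by rewrite lee_fin.
  have [H1|H1] := ltP (H w) 1.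
    apply: le_trans (good w H1); rewrite lee_fin /L.
    rewrite -[leRHS]mulr1 ler_wpM2l ?subr_ge0// ge_max lerBlDr lerDl H0/=.
    exact: ler01.
  rewrite /L max_r ?subr_le0// mulr0.
  exact: sqre_ge0.
rewrite /L; under eq_integral do rewrite EFinM.
rewrite ge0_integralZl_EFin ?subr_ge0//; last 2 first.
- by move=> w _; rewrite lee_fin le_max lexx orbT.
- exact/measurable_EFinP.
rewrite EFinM lee_wpmul2l ?lee_fin ?subr_ge0//.
rewrite EFinB leeBlDr//; apply: le_trans (leeD2l _ intH).
rewrite -ge0_integralD//; last 4 first.
- by move=> w _; rewrite lee_fin le_max lexx orbT.
- exact/measurable_EFinP.
- by move=> w _; rewrite lee_fin.
- exact/measurable_EFinP.
rewrite -(@probability_setT _ _ _ P) -[leLHS]mul1e -integral_cst//.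
apply: le_integral_ge0 => // w.
by rewrite lee_fin -lerBlDr le_max lexx.
Qed.

End tensor_power_integration.

(** * Almost sure exactness when kappa is 1 *)

Lemma ae_wce_eq0 (R : realType) (K1 : R -> R -> R)
    (F1 : rkhs (@unit_itv R) K1) (one1 : F1) (one1E : is_one one1)
    (one1_int : forall f : F1,
       lebesgue_measure.-integrable (@unit_itv R) (EFin \o rkhs_ev f) /\
       (\int[lebesgue_measure]_(x in @unit_itv R) (rkhs_ev f x)%:E
          = (rkhs_ip f one1)%:E)%E)
    (n d : nat) (Fd : rkhs (@cube R d) (@prod_kernel R K1 d)) (oned : Fd)
    (dO : measure_display) (Omega : measurableType dO) (P : probability Omega R)
    (X : 'I_n -> {RV P >-> d.-tuple (measurableTypeR R)}) :
  diag_ess_sup K1 = 1%E -> (0 < n)%N -> is_tensor_power F1 Fd -> is_one oned ->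
  iid_uniform X ->
  {ae P, forall w, wce (fun f : Fd => rkhs_ip f oned) (fun j => X j w) = 0%E}.
Proof.
move=> K1_1 n0 Fd_tensor onedE X_iid; have [Xcube _ Xunif] := X_iid.
have [N [mN N0 subN]] : {ae mrestr lebesgue_measure (measurable_itv `[(0:R), 1]),
    forall x, ((K1 x x)%:E <= 1)%E}.
  by apply/ess_supP; rewrite -[leRHS]K1_1.
pose j0 := Ordinal n0.
(* The event that coordinate [k] of the first point falls in the null set [N], written as a box so
   that the uniform law gives its probability. *)
pose B k := X j0 @^-1` [set x | forall i, (if i == k then N else setT) (tnth x i)].
have mB k : measurable (B k).
  have -> : B k = (fun w => tnth (X j0 w) k) @^-1` N.
    apply/seteqP; split => w /= => [/(_ k)|Nk i]; first by rewrite eqxx.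
    by case: eqVneq => // ->.
  by rewrite -[X in measurable X]setTI; exact: measurable_coord.
have B0 k : P (B k) = 0%E.
  rewrite (Xunif j0 (fun i => if i == k then N else setT)); last first.
    by move=> i; case: ifP.
  by rewrite (bigD1 k)//= eqxx; move: N0; rewrite /= /mrestr => ->; rewrite mul0e.
have aeB : {ae P, forall w, forall k, ~ N (tnth (X j0 w) k)}.
  apply: filter_forall => k; exists (B k); split => // w /= /contrapT Nk i /=.
  by case: eqVneq => // ->.
apply: filterS aeB => w nB.
have Kw k : K1 (tnth (X j0 w) k) (tnth (X j0 w) k) = 1.
  apply/le_anti; rewrite (kernel_diag_ge1 one1E one1_int (Xcube j0 w k)) andbT.
  by rewrite -lee_fin; apply: contrapT => K_gt1; exact/(nB k)/subN.
have Xc j : cube (X j w) by [].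
have [k [kK kE]] := rkhs_representers Fd Xc.
have onorm := ip_oned one1E one1_int Fd_tensor onedE.
(* All weight goes on the first point, where [prod_kernel] is 1 on the diagonal; the squared
   residual is [1 - 2 + 1]. *)
apply: (wce_eq0 kE (c := fun j => (j == j0)%:R)).
apply/eqP; rewrite -normr_eq0 -sqrf_eq0; apply/eqP.
rewrite (sqr_norm_residual onedE onorm Xc kK kE).
have sumD (f : 'I_n -> R) : \sum_j (j == j0)%:R * f j = f j0.
  rewrite (bigD1 j0)// eqxx mul1r big1/= ?addr0// => j /negbTE ->.
  by rewrite mul0r.
have -> : \sum_j (j == j0)%:R = 1 :> R.
  by under eq_bigr do rewrite -[_%:R]mulr1; rewrite sumD.
under eq_bigr do under eq_bigr do rewrite -mulrA.
under eq_bigr do rewrite -mulr_sumr.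
rewrite sumD sumD /prod_kernel big1 => [|i _]; last exact: Kw.
by lra.
Qed.

(** * Choice of the constants *)

Theorem theorem20 (R : realType) (K1 : R -> R -> R)
  (K1_ge0 : forall x y, unit_itv x -> unit_itv y -> 0 <= K1 x y)
  (K1_meas : measurable_fun
     (@unit_itv R `*` @unit_itv R : set (measurableTypeR R * measurableTypeR R))
     (fun p => K1 p.1 p.2))
  (F1 : rkhs (@unit_itv R) K1)
  (one1 : F1) (one1E : is_one one1)
  (one1_int : forall f : F1,
     lebesgue_measure.-integrable (@unit_itv R) (EFin \o rkhs_ev f) /\
     (\int[lebesgue_measure]_(x in @unit_itv R) (rkhs_ev f x)%:E
        = (rkhs_ip f one1)%:E)%E) :
  ((1 < diag_ess_sup K1)%E ->
   forall delta : R, 0 < delta ->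
   exists (c a : R), [/\ 0 < c, 1 < a &
     forall n d : nat, (0 < n)%N -> (0 < d)%N -> n%:R <= c * a ^+ d ->
     forall (Fd : rkhs (@cube R d) (@prod_kernel R K1 d)),
       is_tensor_power F1 Fd ->
     forall oned : Fd, is_one oned ->
     forall (dO : measure_display) (Omega : measurableType dO)
       (P : probability Omega R)
       (X : 'I_n -> {RV P >-> d.-tuple (measurableTypeR R)}),
       iid_uniform X ->
     ((1 - delta)%:E <=
        \int[P]_w (wce (fun f : Fd => rkhs_ip f oned) (fun j => X j w)) ^+ 2)%E])
  /\
  (diag_ess_sup K1 = 1%E ->
   forall n d : nat, (0 < n)%N -> (0 < d)%N ->
   forall (Fd : rkhs (@cube R d) (@prod_kernel R K1 d)),
     is_tensor_power F1 Fd ->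
   forall oned : Fd, is_one oned ->
   forall (dO : measure_display) (Omega : measurableType dO)
     (P : probability Omega R)
     (X : 'I_n -> {RV P >-> d.-tuple (measurableTypeR R)}),
     iid_uniform X ->
   {ae P, forall w,
      wce (fun f : Fd => rkhs_ip f oned) (fun j => X j w) = 0%E}).
Proof.
split=> [K1_gt1 delta delta_gt0|K1_1 n d n0 _ Fd Fd_tensor oned onedE dO Omega P X]; last first.
  exact: (ae_wce_eq0 one1E one1_int).
have [q /andP[q0 q1] intq] := integral_inv_diag_lt1 K1_meas one1E one1_int K1_gt1.
pose D := Num.min delta 1.
have D0 : 0 < D by rewrite lt_min delta_gt0 ltr01.
have D1 : D <= 1 by rewrite ge_min lexx orbT.
(* The diagonal threshold will be [b = a ^+ 3], and [n] contributes one more factor [a ^+ d]; hence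
   the fourth power. The maximum with one half covers [q = 0]. *)
have [a a1 aq] : exists2 a : R, 1 < a & a ^+ 4 * q <= 1.
  pose p := Num.max q 2^-1.
  have p0 : 0 < p by rewrite lt_max invr_gt0 ltr0n orbT.
  have p1 : p < 1 by rewrite gt_max q1 invf_lt1 ?ltr1n.
  exists (Num.sqrt (Num.sqrt p^-1)).
    by rewrite -[ltLHS]sqrtr1 ltr_sqrt ?sqrtr_gt0 ?invr_gt0// -[ltLHS]sqrtr1
      ltr_sqrt ?invr_gt0// invf_gt1.
  rewrite (exprM _ 2 2) !sqr_sqrtr ?sqrtr_ge0 ?invr_ge0 ?(ltW p0)//.
  by rewrite mulrC ler_pdivrMr// mul1r le_max lexx.
pose e := D / 4; pose c := D / 4.
have a0 : 0 < a by rewrite (lt_trans ltr01).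
exists c, a; split => //; first by rewrite divr_gt0.
move=> n d n0 _ nca Fd Fd_tensor oned onedE dO Omega P X X_iid.
have n1 : 1 <= n%:R :> R by rewrite ler1n.
(* Chosen so that the off-diagonal contribution [n%:R ^+ 2 / M] is exactly [D / 4]. *)
pose M : R := 4 * n%:R ^+ 2 / D.
have M0 : 0 < M by rewrite divr_gt0// mulr_gt0// exprn_gt0// (lt_le_trans ltr01).
have ad0 : 0 < a ^+ d by rewrite exprn_gt0.
(* The left side is of order [n ^ 3], and [n] is at most [D / 4 * a ^+ d]; this is why [b] is the
   cube of [a]. *)
have step1 : n%:R / e + n%:R * M <= (a ^+ 3) ^+ d.
  rewrite -exprM mulnC exprM; set A := a ^+ d in nca ad0 *.
  have n3 : n%:R ^+ 3 <= (D / 4 * A) ^+ 3.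
    by rewrite lerXn2r// nnegrE ?ler0n// mulr_ge0 ?ltW// divr_gt0.
  have -> : n%:R / e + n%:R * M = (n%:R + n%:R ^+ 3) * (4 / D).
    by rewrite /e /M; field; rewrite gt_eqF.
  have n13 : n%:R <= n%:R ^+ 3 :> R by rewrite -[leLHS]expr1 ler_weXn2l.
  apply: (@le_trans _ _ ((D / 4 * A) ^+ 3 * 2 * (4 / D))).
    apply: ler_wpM2r; [by rewrite divr_ge0 ?ltW|lra].
  have -> : (D / 4 * A) ^+ 3 * 2 * (4 / D) = (D ^+ 2 / 8) * A ^+ 3.
    by field; rewrite gt_eqF.
  by rewrite ler_piMl ?exprn_ge0 ?(ltW ad0)//; nra.
have step2 : n%:R * (a ^+ 3 * q) ^+ d <= D / 4.
  apply: (@le_trans _ _ (c * a ^+ d * (a ^+ 3 * q) ^+ d)).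
    by rewrite ler_wpM2r// exprn_ge0// mulr_ge0// exprn_ge0// ltW.
  rewrite -mulrA -exprMn mulrA -exprS -[leRHS]mulr1 ler_wpM2l ?divr_ge0 ?(ltW D0)//.
  by rewrite exprn_ile1// mulr_ge0// exprn_ge0// ltW.
have step3 : n%:R ^+ 2 / M = D / 4.
  by rewrite /M; field; rewrite !gt_eqF// (lt_le_trans ltr01).
have e01 : 0 < e <= 1 by rewrite /e; lra.
have b0 : 0 < a ^+ 3 by rewrite exprn_gt0.
have := wce_expectation_ge K1_ge0 K1_meas one1E one1_int Fd_tensor onedE X_iid
  q0 intq b0 M0 e01 step1.
apply: le_trans; rewrite lee_fin step3.
have Dd : D <= delta by rewrite ge_min lexx.
(* What remains is [(1 - D / 4) * (1 - D / 2) >= 1 - D >= 1 - delta]. *)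
move: step2; set Y := _ * _ ^+ d => step2.
by rewrite /e; nra.
Qed.
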